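(* If $\lambda\in C_3$, then $t_{\mathrm{cut}}(\lambda)=t^1_{\mathrm{conj}}(\lambda)=t^1_{\mathrm{MAX}}(\lambda)=+\infty$.
   Context: Let $G=\mathbb R^5$ with coordinates $(x,y,z,v,w)$ (the Cartan group, identity $0$), vector fields $X_1=\partial_x-\frac y2\partial_z-\frac{x^2+y^2}{2}\partial_w$, $X_2=\partial_y+\frac x2\partial_z+\frac{x^2+y^2}{2}\partial_v$; sub-Riemannian problem $\dot g=u_1X_1+u_2X_2$, fixed endpoints, minimize $\int\sqrt{u_1^2+u_2^2}\,dt$. For $\lambda=(\theta,c,\alpha,\beta)$, $\theta,\beta\in S^1$, $c\in\mathbb R$, $\alpha\ge0$: $\mathrm{Exp}(\lambda,t)=g(t)$ with $g(0)=0$, $\dot g=\cos\theta(t)X_1+\sin\theta(t)X_2$, $\dot\theta=c$, $\dot c=-\alpha\sin(\theta-\beta)$, $(\theta(0),c(0))=(\theta,c)$. $E=\frac{c^2}2-\alpha\cos(\theta-\beta)$; $C_3=\{\alpha>0,\ E=\alpha,\ \theta-\beta\ne\pi\}$. $t_{\mathrm{cut}}(\lambda)=\sup\{t>0:\mathrm{Exp}(\lambda,\cdot)|_{[0,t]}\text{ is length minimizing}\}$; $t^1_{\mathrm{conj}}(\lambda)=\sup\{t>0:\mathrm{Exp}(\lambda,\cdot)|_{[0,t]}\text{ is locally optimal}\}$ (minimizing among admissible curves with same endpoints in a $C([0,t],G)$-neighborhood). The first Maxwell time $t^1_{\mathrm{MAX}}$ is defined to be $+\infty$ on $C_3$. 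*)

(* Defs.v *)
From HB Require Import structures.
From mathcomp Require Import all_boot all_order all_algebra.
From mathcomp Require Import all_classical all_reals all_analysis.
Set Implicit Arguments. Unset Strict Implicit. Unset Printing Implicit Defensive.
Import Order.TTheory GRing.Theory Num.Theory.
Import numFieldNormedType.Exports.
Local Open Scope classical_set_scope.
Local Open Scope ring_scope.

(* Points of the Cartan group G = R^5, coordinates (x,y,z,v,w). *)
Record pt (R : Type) := Pt { px : R; py : R; pz : R; pv : R; pw : R }.
Arguments Pt {R}.

Definition origin (R : realType) : pt R := Pt 0 0 0 0 0.

Definition coords (R : Type) (f : pt R -> R) : Prop :=
  f = @px R \/ f = @py R \/ f = @pz R \/ f = @pv R \/ f = @pw R.

(* u1 X1(p) + u2 X2(p), with
   X1 = d_x - y/2 d_z - (x^2+y^2)/2 d_w,  X2 = d_y + x/2 d_z + (x^2+y^2)/2 d_v. *)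
Definition dyn (R : realType) (u1 u2 : R) (p : pt R) : pt R :=
  let r := (px p ^+ 2 + py p ^+ 2) / 2 in
  Pt u1 u2 (u1 * (- (py p / 2)) + u2 * (px p / 2)) (u2 * r) (u1 * (- r)).

Definition mu (R : realType) := @lebesgue_measure R.
Arguments mu : clear implicits.

(* Admissible trajectory on [0,T]: controls u1,u2 in L^oo[0,T] (measurable and
   bounded), and h a (continuous) solution of dh/ds = u1 X1(h) + u2 X2(h)
   in integral (Caratheodory) form on [0,T]. *)
Definition admissible (R : realType) (T : R) (u1 u2 : R -> R) (h : R -> pt R)
  : Prop :=
  [/\ measurable_fun `[0, T] u1, measurable_fun `[0, T] u2,
      (exists M : R, forall s, 0 <= s <= T -> `|u1 s| <= M /\ `|u2 s| <= M),
      (forall f, coords f -> {within `[0, T], continuous (f \o h)}) &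
      (forall s, 0 <= s <= T -> forall f, coords f ->
         f (h s) = f (h 0) +
           Rintegral (mu R) `[0, s] (fun r => f (dyn (u1 r) (u2 r) (h r))))].

Definition sr_length (R : realType) (T : R) (u1 u2 : R -> R) : \bar R :=
  let D : set R := `[0, T]%classic in
  (\int[mu R]_(s in D) (Num.sqrt (u1 s ^+ 2 + u2 s ^+ 2))%:E)%E.

(* The extremal trajectory Exp(lambda, .) for lambda = (th0, c0, alpha, beta):
   g(0)=0, g' = cos th X1 + sin th X2, th' = c, c' = -alpha sin(th - beta),
   (th(0), c(0)) = (th0, c0).  Angles are represented by real lifts. *)
Definition is_Exp (R : realType) (th0 c0 alpha beta : R)
  (th c : R -> R) (g : R -> pt R) : Prop :=
  [/\ th 0 = th0, c 0 = c0, g 0 = origin R &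
      forall t : R,
        [/\ is_derive t 1 th (c t),
            is_derive t 1 c (- alpha * sin (th t - beta)) &
            forall f, coords f ->
              is_derive t 1 (f \o g) (f (dyn (cos (th t)) (sin (th t)) (g t)))]].

(* Exp(lambda,.)|[0,t] is length minimizing among all admissible curves on
   [0,t] with the same endpoints (its control is (cos th, sin th)). *)
Definition minimizing_on (R : realType) (t : R) (th : R -> R) (g : R -> pt R)
  : Prop :=
  forall (w1 w2 : R -> R) (h : R -> pt R),
    admissible t w1 w2 h -> h 0 = g 0 -> h t = g t ->
    (sr_length t (fun s => cos (th s)) (fun s => sin (th s))
      <= sr_length t w1 w2)%E.

Definition C0_close (R : realType) (t eps : R) (h g : R -> pt R) : Prop :=
  forall s, 0 <= s <= t -> forall f, coords f -> `|f (h s) - f (g s)| < eps.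

Definition locally_optimal_on (R : realType) (t : R) (th : R -> R)
  (g : R -> pt R) : Prop :=
  exists2 eps : R, 0 < eps &
  forall (w1 w2 : R -> R) (h : R -> pt R),
    admissible t w1 w2 h -> C0_close t eps h g -> h 0 = g 0 -> h t = g t ->
    (sr_length t (fun s => cos (th s)) (fun s => sin (th s))
      <= sr_length t w1 w2)%E.

Definition t_cut (R : realType) (th : R -> R) (g : R -> pt R) : \bar R :=
  ereal_sup [set t%:E | t in [set t : R | 0 < t /\ minimizing_on t th g]].

Definition t_conj1 (R : realType) (th : R -> R) (g : R -> pt R) : \bar R :=
  ereal_sup [set t%:E | t in [set t : R | 0 < t /\ locally_optimal_on t th g]].

(* The first Maxwell time is defined to be +oo on C_3. *)
Definition t_MAX1_C3 (R : realType) : \bar R := +oo%E.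

Definition energy (R : realType) (th c alpha beta : R) : R :=
  c ^+ 2 / 2 - alpha * cos (th - beta).

Definition in_C3 (R : realType) (th c alpha beta : R) : Prop :=
  [/\ 0 < alpha, energy th c alpha beta = alpha &
      ~ (exists k : int, th - beta = pi + 2 * k%:~R * pi)].

(* Main.v *)
(* Rotate the plane by beta and shift it so that X' = cos (theta - beta) and
   c = - alpha Y.  Then int Y^2 dX is determined by the endpoints of a
   horizontal curve.  Put e = (length so far) + X and q = Y^2 / 2: since
   ds^2 = dX^2 + dY^2, one gets Y^2 dX = (q - (dq/de)^2 / 2) de, so int Y^2 dX
   is the action of a free fall, a concave functional.  Its extremals q'' = -1
   have momentum p = p0 - e, and
     Phi = int Y^2 dX + p q + p^3 / 6
   does not increase along any horizontal curve (AM-GM), while it is constant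
   along the Euler soliton.  Comparing the final values of Phi on the soliton
   and on a competitor with the same endpoints, the strict monotonicity of
   p |-> p q + p^3 / 6 gives p_competitor <= p_soliton, i.e. the competitor is
   at least as long. *)
Require Import Defs.
From HB Require Import structures.
From mathcomp Require Import all_boot all_order all_algebra.
From mathcomp Require Import all_classical all_reals all_analysis.
From mathcomp Require Import measurable_realfun ring lra.
Set Implicit Arguments.
Unset Strict Implicit.
Unset Printing Implicit Defensive.
Import Order.TTheory GRing.Theory Num.Theory.
Import numFieldNormedType.Exports.
Local Open Scope classical_set_scope.
Local Open Scope ring_scope.

(** * Primitives of bounded measurable functions *)

(** Cutting [[0, s]] into [n + 1] equal pieces bounds [|D s - D 0|] by [C s^2 / (n + 1)], which is
    arbitrarily small. *)
Lemma quadratic_variation_cst (R : realType) (T C : R) (D : R -> R) :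
  (forall s r, 0 <= s -> s <= r -> r <= T ->
     `|D r - D s| <= C * (r - s) ^+ 2) ->
  forall s, 0 <= s <= T -> D s = D 0.
Proof.
move=> DC s /andP[s0 sT].
have subdiv n k : (k <= n.+1)%N ->
    `|D (k%:R * (s / n.+1%:R)) - D 0| <= k%:R * (C * (s / n.+1%:R) ^+ 2).
  elim: k => [|k IHk] kn; first by rewrite !mul0r subrr normr0.
  have h0 : 0 <= s / n.+1%:R by rewrite divr_ge0.
  have step : `|D (k.+1%:R * (s / n.+1%:R)) - D (k%:R * (s / n.+1%:R))|
      <= C * (s / n.+1%:R) ^+ 2.
    rewrite [X in _ <= C * X ^+ 2](_ : _ =
      k.+1%:R * (s / n.+1%:R) - k%:R * (s / n.+1%:R)); last first.
      by rewrite -natr1; ring.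
    apply: DC; first by rewrite mulr_ge0.
      by rewrite ler_wpM2r// ler_nat.
    rewrite (le_trans _ sT)// mulrCA ler_piMr// ler_pdivrMr// mul1r ler_nat//.
  rewrite (le_trans (ler_distD (D (k%:R * (s / n.+1%:R))) _ _))//.
  rewrite -[in leRHS]natr1 [in leRHS]mulrDl mul1r [leRHS]addrC lerD//.
  by rewrite IHk// ltnW.
apply/eqP; rewrite -subr_eq0 -normr_eq0 eq_le normr_ge0 andbT leNgt.
apply/negP => d0.
have Cs n : `|D s - D 0| * n.+1%:R <= C * s ^+ 2.
  have := subdiv n n.+1 (leqnn _).
  have -> : n.+1%:R * (s / n.+1%:R) = s by rewrite mulrC divfK.
  rewrite -(@ler_pM2r _ n.+1%:R)// => /le_trans; apply.
  by rewrite le_eqVlt; apply/orP; left; apply/eqP; field.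
have := Cs (Num.truncn ((C * s ^+ 2) / `|D s - D 0|)).
rewrite -ler_pdivlMl// mulrC leNgt => /negP; apply.
exact: truncnS_gt.
Qed.

Definition bounded_measurable (R : realType) (T : R) (f : R -> R) : Prop :=
  measurable_fun `[0, T] f /\
  exists M : R, forall s, 0 <= s <= T -> `|f s| <= M.

(** Boundedness of [F] is included so that the integrand [f G + F g] of the product rule is again
    bounded and measurable. *)
Definition primitive (R : realType) (T : R) (F f : R -> R) : Prop :=
  [/\ bounded_measurable T F, bounded_measurable T f &
      forall s, 0 <= s <= T -> F s = F 0 + Rintegral (mu R) `[0, s] f].

Section bounded_measurable.
Context (R : realType) (T : R).
Implicit Types (f g : R -> R) (a : R).

Lemma bounded_measurable_cst a : bounded_measurable T (cst a).
Proof. by split => //; exists `|a|. Qed.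

Lemma bounded_measurableD f g : bounded_measurable T f ->
  bounded_measurable T g -> bounded_measurable T (f \+ g).
Proof.
move=> [mf [M fM]] [mg [N gN]]; split; first exact: measurable_funD.
by exists (M + N) => s sT; rewrite (le_trans (ler_normD _ _))// lerD ?fM ?gN.
Qed.

Lemma bounded_measurableM f g : bounded_measurable T f ->
  bounded_measurable T g -> bounded_measurable T (f \* g).
Proof.
move=> [mf [M fM]] [mg [N gN]]; split; first exact: measurable_funM.
by exists (M * N) => s sT; rewrite normrM ler_pM ?fM ?gN.
Qed.

Lemma bounded_measurable_integrable f (i : interval R) :
  [set` i] `<=` `[0, T] -> bounded_measurable T f ->
  (mu R).-integrable [set` i] (EFin \o f).
Proof.
move=> iT [mf [M fM]].
apply: (@integrableS _ _ _ (mu R) `[0, T]%classic) => //.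
apply: measurable_bounded_integrable => //.
  have := lebesgue_measure_itv `[0, T]; rewrite /= => ->.
  by case: ifP => // _; rewrite ltry.
exists M; split; first exact: num_real.
move=> x Mx s /= sT; rewrite (le_trans (fM s _) (ltW Mx))//.

Qed.

Lemma primitive_increment F f s r : primitive T F f ->
  0 <= s -> s <= r -> r <= T -> F r - F s = Rintegral (mu R) `]s, r] f.
Proof.
move=> [_ bf Ff] s0 sr rT.
rewrite (Ff r) ?(le_trans s0 sr)// (Ff s) ?s0 ?(le_trans sr)//.
rewrite opprD addrACA subrr add0r.
rewrite -(@Rintegral_itvB _ f (BLeft 0) (BRight r) s)//.
apply: bounded_measurable_integrable => // x /=.
by rewrite !in_itv/= => /andP[-> /le_trans]; apply.
Qed.

Lemma Rintegral_le_bound f s r M : bounded_measurable T f ->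
  0 <= s -> s <= r -> r <= T ->
  (forall x, s < x <= r -> `|f x| <= M) ->
  `|Rintegral (mu R) `]s, r] f| <= M * (r - s).
Proof.
move=> bf s0 sr rT fM.
have srT : [set` `]s, r]] `<=` `[0, T].
  move=> x /=; rewrite !in_itv/= => /andP[sx xr].
  by rewrite (le_trans s0 (ltW sx)) (le_trans xr).
have intf := @bounded_measurable_integrable f `]s, r] srT bf.
rewrite (le_trans (le_normr_Rintegral _ intf))//.
have -> : M * (r - s) = Rintegral (mu R) `]s, r] (cst M).
  rewrite Rintegral_cst// /mu.
  have := lebesgue_measure_itv `]s, r]; rewrite /= => ->.
  case: ifPn => [_ //|]; rewrite lte_fin -leNgt => rs /=.
  by rewrite (_ : r = s) ?subrr//; apply/eqP; rewrite eq_le rs.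
apply: le_Rintegral => //.
- by have /integrable_norm := intf.
- apply: (@bounded_measurable_integrable (cst M)) => //.
  exact: bounded_measurable_cst.
Qed.

Lemma primitive_lipschitz F f M s r : primitive T F f ->
  (forall x, 0 <= x <= T -> `|f x| <= M) ->
  0 <= s -> s <= r -> r <= T -> `|F r - F s| <= M * (r - s).
Proof.
move=> pF fM s0 sr rT; rewrite (primitive_increment pF)//.
case: pF => _ bf _; apply: Rintegral_le_bound => // x /andP[sx xr].
by apply: fM; rewrite (le_trans s0 (ltW sx)) (le_trans xr).
Qed.

End bounded_measurable.

Section primitive.
Context (R : realType) (T : R).
Implicit Types (F G f g : R -> R) (a : R).

Lemma primitive_cst a : primitive T (cst a) (cst 0).
Proof.
split; [exact: bounded_measurable_cst..|move=> s _].
by rewrite Rintegral_cst// mul0r addr0.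
Qed.

Lemma primitiveD F G f g : primitive T F f -> primitive T G g ->
  primitive T (F \+ G) (f \+ g).
Proof.
move=> [bF bf Ff] [bG bg Gg]; split; [exact: bounded_measurableD..|].
move=> s /andP[s0 sT] /=.
have sub : [set` `[0, s]] `<=` `[0, T].
  by move=> x /=; rewrite !in_itv/= => /andP[-> /le_trans]; apply.
rewrite (Ff s) ?s0// (Gg s) ?s0// RintegralD//; first by rewrite addrACA.
- exact: (bounded_measurable_integrable sub bf).
- exact: (bounded_measurable_integrable sub bg).
Qed.

(* The increment over [s, r] of the difference of the two sides is
   O((r - s)^2), so no almost everywhere differentiation is needed. *)
Lemma primitiveM F G f g : primitive T F f -> primitive T G g ->
  primitive T (F \* G) (f \* G \+ F \* g).
Proof.
move=> pF pG; have [bF bf _] := pF; have [bG bg _] := pG.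
have bd : bounded_measurable T (f \* G \+ F \* g).
  by apply: bounded_measurableD; exact: bounded_measurableM.
split => //; first exact: bounded_measurableM.
have [_ [M fM]] := bf; have [_ [N gN]] := bg.
pose D s := F s * G s - Rintegral (mu R) `[0, s] (f \* G \+ F \* g).
suff DC s r : 0 <= s -> s <= r -> r <= T ->
    `|D r - D s| <= (M * N + M * N) * (r - s) ^+ 2.
  move=> s sT; have := quadratic_variation_cst DC sT.
  rewrite /D set_itv1 Rintegral_set1 subr0 /= => <-.
  by rewrite subrK.
move=> s0 sr rT.
have srT : [set` `]s, r]] `<=` `[0, T].
  move=> x /=; rewrite !in_itv/= => /andP[sx xr].
  by rewrite (le_trans s0 (ltW sx)) (le_trans xr).
have rT' : [set` `[0, r]] `<=` `[0, T].
  by move=> x /=; rewrite !in_itv/= => /andP[-> /le_trans]; apply.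
have bfr a : bounded_measurable T (f \* cst a).
  by apply: bounded_measurableM => //; exact: bounded_measurable_cst.
have bgr a : bounded_measurable T (cst a \* g).
  by apply: bounded_measurableM => //; exact: bounded_measurable_cst.
have intp (h : R -> R) : bounded_measurable T h ->
  (mu R).-integrable `]s, r] (EFin \o h).
  exact: bounded_measurable_integrable.
have bdiff : bounded_measurable T
    ((f \* cst (G s) \+ cst (F r) \* g) \+ cst (-1) \* (f \* G \+ F \* g)).
  apply: bounded_measurableD; first exact: bounded_measurableD.
  by apply: bounded_measurableM => //; exact: bounded_measurable_cst.
(* From [F r G r - F s G s = (F r - F s) G s + F r (G r - G s)], the integrand at [x] is
   [f x (G s - G x) + (F r - F x) g x]. The Lipschitz bounds make each term [O(r - s)], and
   integrating over []s, r]] gives the second factor. *)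
have -> : D r - D s = Rintegral (mu R) `]s, r]
    ((f \* cst (G s) \+ cst (F r) \* g) \+ cst (-1) \* (f \* G \+ F \* g)).
  rewrite RintegralD//; last 2 first.
  - by apply: intp; exact: bounded_measurableD.
  - apply: intp; apply: bounded_measurableM => //.
    exact: bounded_measurable_cst.
  rewrite RintegralD//; [|exact: intp..].
  rewrite RintegralZr//; last exact: intp.
  rewrite RintegralZl//; last exact: intp.
  rewrite RintegralZl//; last exact: intp.
  rewrite -(primitive_increment pF)// -(primitive_increment pG)//.
  rewrite -(@Rintegral_itvB _ (f \* G \+ F \* g) (BLeft 0) (BRight r) s)//;
    last first.
    exact: (bounded_measurable_integrable rT' bd).
  by rewrite /D; ring.
rewrite expr2 mulrA; apply: (Rintegral_le_bound bdiff) => // x /andP[sx xr].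
have x0 : 0 <= x by rewrite (le_trans s0)// ltW.
have xT : x <= T by rewrite (le_trans xr).
rewrite [X in `|X|](_ : _ = f x * (G s - G x) + (F r - F x) * g x); last first.
  by rewrite /=; ring.
rewrite (le_trans (ler_normD _ _))// !normrM mulrDl lerD//.
- rewrite -mulrA ler_pM// ?fM ?x0// distrC.
  rewrite (le_trans (primitive_lipschitz pG gN s0 (ltW sx) xT))//.
  rewrite ler_wpM2l//; last by rewrite lerD2r.
  by rewrite (le_trans _ (gN x _))// x0.
- rewrite mulrAC ler_pM// ?gN ?x0//.
  rewrite (le_trans (primitive_lipschitz pF fM x0 xr rT))//.
  rewrite ler_wpM2l//; last by rewrite lerD2l lerN2 ltW.
  by rewrite (le_trans _ (fM x _))// x0.
Qed.

Lemma primitive_le F f : 0 <= T -> primitive T F f ->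
  (forall s, 0 <= s <= T -> f s <= 0) -> F T <= F 0.
Proof.
move=> T0 [_ bf Ff] f0; rewrite (Ff T) ?T0 ?lexx// gerDl.
rewrite -oppr_ge0 -mulN1r -RintegralZl//; last first.
  exact: (bounded_measurable_integrable (@subset_refl _ _) bf).
apply: Rintegral_ge0 => x /=; rewrite in_itv/= => xT.
by rewrite mulN1r oppr_ge0 f0.
Qed.

Lemma primitive_Rintegral f : bounded_measurable T f ->
  primitive T (fun s => Rintegral (mu R) `[0, s] f) f.
Proof.
move=> bf.
(* For [T < 0] the interval is empty and every clause is vacuous. *)
have [T0|T0] := leP 0 T; last first.
  have empty s : ~ 0 <= s <= T.
    by move=> /andP[s0 sT]; move: (le_trans s0 sT); rewrite leNgt T0.
  split => //; last by move=> s /empty.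
  split; last by exists 0 => s /empty.
  by rewrite set_itv_ge ?bnd_simp -?ltNge//; exact: measurable_fun_set0.
have intf : (mu R).-integrable `[0, T] (EFin \o f).
  exact: (bounded_measurable_integrable (@subset_refl _ _) bf).
have [mf [M fM]] := bf.
split => //; last by move=> s _; rewrite set_itv1 Rintegral_set1 add0r.
split.
  apply: subspace_continuous_measurable_fun => //.
  exact: parameterized_integral_continuous.
exists (M * T) => s /andP[s0 sT].
rewrite -(@Rintegral_itv_obnd_cbnd _ 0); last first.
  apply: bounded_measurable_integrable bf => x /=.
  by rewrite !in_itv/= => /andP[/ltW -> /le_trans]; apply.
apply: (le_trans (Rintegral_le_bound bf _ _ _ _)); [by []|exact: s0|by []| |].
  move=> x /andP[x0 xs]; apply: fM.
  by rewrite (ltW x0) (le_trans xs).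
rewrite subr0 ler_wpM2l//.
by rewrite (le_trans _ (fM 0 _))// lexx.
Qed.

End primitive.

(** * The calibration *)

Section calibration.
Context (R : realType).
Implicit Types (p : pt R) (a b k m l : R).

(** With [(a, b)] the unit vector of angle [beta], [along] and [across] are the rotated coordinates
    [X] and [Y], the latter shifted by [k]. *)
Definition along a b p : R := a * px p + b * py p.

Definition across a b k p : R := - b * px p + a * py p - k.

(* Its derivative along a horizontal curve is [across ^+ 2] times the velocity
   of [along]. *)
Definition second_moment a b k p : R :=
  2 * (b * pv p - a * pw p) - along a b p ^+ 3 / 3
  - 2 * k * (along a b p * across a b 0 p / 2 - pz p) + k ^+ 2 * along a b p.

(** This is [p0 - e]: [m] stands for [p0] and [l] for the length covered so far. *)
Definition momentum a b m l p : R := m - l - along a b p.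

Definition calibration a b k m l p : R :=
  second_moment a b k p + momentum a b m l p * (across a b k p ^+ 2 / 2)
  + momentum a b m l p ^+ 3 / 6.

Lemma coordsP (P : (pt R -> R) -> Prop) :
  (forall f : pt R -> R, coords f -> P f) ->
  [/\ P (@px R), P (@py R), P (@pz R), P (@pv R) & P (@pw R)].
Proof. by move=> H; split; apply: H; rewrite /coords; tauto. Qed.

(* Here [D F f] reads ``f is a derivative of F'': it is instantiated both by
   classical derivatives and by Lebesgue primitives. *)
Lemma calibration_derivation (D : (R -> R) -> (R -> R) -> Prop)
    a b k m (h : R -> pt R) (u1 u2 l n : R -> R) :
  a ^+ 2 + b ^+ 2 = 1 ->
  (forall x, D (cst x) (cst 0)) ->
  (forall F G f g, D F f -> D G g -> D (F \+ G) (f \+ g)) ->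
  (forall F G f g, D F f -> D G g -> D (F \* G) (f \* G \+ F \* g)) ->
  (forall f : pt R -> R, coords f ->
     D (f \o h) (fun s => f (dyn (u1 s) (u2 s) (h s)))) ->
  D l n ->
  exists2 phi, D (fun s => calibration a b k m (l s) (h s)) phi &
  forall s, let v1 := a * u1 s + b * u2 s in let v2 := - b * u1 s + a * u2 s in
    let q := across a b k (h s) in let p := momentum a b m (l s) (h s) in
    phi s = q ^+ 2 * v1 - (n s + v1) * q ^+ 2 / 2 + p * q * v2
            - p ^+ 2 * (n s + v1) / 2.
Proof.
move=> ab D0 DD DM /coordsP[Dx Dy Dz Dv Dw] Dl.
(* The calibration is assembled as a polynomial: [DX], [DYk] and [Dp] differentiate [X], the shifted
   [Y] and the momentum, [DS] the second moment, [Dpq] and [Dp3] the last two terms. *)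
have DZ x F f (DF : D F f) := DM _ _ _ _ (D0 x) DF.
have DX := DD _ _ _ _ (DZ a _ _ Dx) (DZ b _ _ Dy).
have DY := DD _ _ _ _ (DZ (- b) _ _ Dx) (DZ a _ _ Dy).
have DYk := DD _ _ _ _ DY (D0 (- k)).
have Dp := DD _ _ _ _ (D0 m) (DZ (-1) _ _ (DD _ _ _ _ Dl DX)).
have DM1 := DD _ _ _ _ (DZ (2 * b) _ _ Dv) (DZ (- (2 * a)) _ _ Dw).
have DX3 := DZ (- 3^-1) _ _ (DM _ _ _ _ DX (DM _ _ _ _ DX DX)).
have DXY := DZ (- k) _ _ (DM _ _ _ _ DX DY).
have DkX := DD _ _ _ _ (DZ (2 * k) _ _ Dz) (DZ (k ^+ 2) _ _ DX).
have DS := DD _ _ _ _ DM1 (DD _ _ _ _ DX3 (DD _ _ _ _ DXY DkX)).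
have Dpq := DZ 2^-1 _ _ (DM _ _ _ _ Dp (DM _ _ _ _ DYk DYk)).
have Dp3 := DZ 6^-1 _ _ (DM _ _ _ _ Dp (DM _ _ _ _ Dp Dp)).
have := DD _ _ _ _ DS (DD _ _ _ _ Dpq Dp3).
set F := (X in D X _); set phi := (X in D _ X) => DF.
exists phi.
  rewrite (_ : (fun s => _) = F)//; apply/funext => s.
  by rewrite /F /calibration /second_moment /momentum /across /along /=; field.
move=> s v1 v2 q p; rewrite /v1 /v2 /q /p /phi.
(* The unit norm of [(a, b)] expresses that the rotation preserves both [x^2 + y^2], the rate of [v]
   and [w], and [x dy - y dx], the rate of [z]. *)
have b2 : b ^+ 2 = 1 - a ^+ 2 by rewrite -ab; ring.
rewrite /calibration /second_moment /momentum /across /along /=.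
move: (px _) (py _) (pz _) (pv _) (pw _) (u1 s) (u2 s) (l s) (n s) => x y z v w.
move=> w1 w2 L N.
by field: b2.
Qed.

(** The rate is [-(A + B - 2 p q v2) / 2] with [A = q^2 (n - v1)] and [B = p^2 (n + v1)]. Since
    [v2^2 = (n - v1) (n + v1)], one has [(2 p q v2)^2 = 4 A B <= (A + B)^2]; comparing squares
    avoids the roots of [n - v1] and [n + v1]. *)
Lemma calibration_rate_le0 (n v1 v2 q p : R) : 0 <= n ->
  n ^+ 2 = v1 ^+ 2 + v2 ^+ 2 ->
  q ^+ 2 * v1 - (n + v1) * q ^+ 2 / 2 + p * q * v2 - p ^+ 2 * (n + v1) / 2 <= 0.
Proof.
move=> n0 nv.
have v1n : `|v1| <= n.
  rewrite -(@ler_pXn2r _ 2) ?nnegrE// nv real_normK ?num_real//.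
  by rewrite lerDl sqr_ge0.
have e0 : 0 <= n + v1 by move: v1n; rewrite ler_norml => /andP[]; lra.
have d0 : 0 <= n - v1 by move: v1n; rewrite ler_norml => /andP[]; lra.
have S0 : 0 <= q ^+ 2 * (n - v1) + p ^+ 2 * (n + v1).
  by rewrite addr_ge0// mulr_ge0// sqr_ge0.
have : `|2 * p * q * v2| <= q ^+ 2 * (n - v1) + p ^+ 2 * (n + v1).
  rewrite -(@ler_pXn2r _ 2) ?nnegrE// real_normK ?num_real//.
  rewrite -subr_ge0 (_ : _ - _ = (q ^+ 2 * (n - v1) - p ^+ 2 * (n + v1)) ^+ 2).
    exact: sqr_ge0.
  have -> : (2 * p * q * v2) ^+ 2 = 4 * p ^+ 2 * q ^+ 2 * (n ^+ 2 - v1 ^+ 2).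
    by rewrite nv; ring.
  by ring.
by move=> /(le_trans (ler_norm _)); lra.
Qed.

End calibration.

(** * Monotonicity of the calibration along admissible curves *)

Lemma bounded_measurable_within_continuous (R : realType) (T : R) (f : R -> R) :
  {within `[0, T], continuous f} -> bounded_measurable T f.
Proof.
move=> cf; split; first exact: subspace_continuous_measurable_fun.
have : compact [set f x | x in `[0, T]].
  by apply: continuous_compact => //; exact: segment_compact.
move=> /compact_bounded[M [_ Mf]].
exists (M + 1) => s sT; apply: (Mf (M + 1)); first by rewrite ltrDl.
by exists s => //=; rewrite in_itv.
Qed.

Lemma bounded_measurable_sqrt (R : realType) (T : R) (f : R -> R) :
  bounded_measurable T f -> bounded_measurable T (fun s => Num.sqrt (f s)).
Proof.
move=> [mf [M fM]]; split.
  apply: measurableT_comp => //.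
  by apply: continuous_measurable_fun; exact: sqrt_continuous.
exists (Num.sqrt M) => s sT; rewrite ger0_norm ?sqrtr_ge0// ler_sqrt.
  by rewrite (le_trans (ler_norm _)) ?fM.
by rewrite (le_trans _ (fM s sT)).
Qed.

Section admissible.
Context (R : realType) (T : R) (w1 w2 : R -> R) (h : R -> pt R).
Hypotheses (T0 : 0 <= T) (hadm : admissible T w1 w2 h).

Let b1 : bounded_measurable T w1.
Proof.
by have [m1 _ [M wM] _ _] := hadm; split=> //; exists M => s /wM[].
Qed.

Let b2 : bounded_measurable T w2.
Proof.
by have [_ m2 [M wM] _ _] := hadm; split=> //; exists M => s /wM[].
Qed.

Lemma bounded_measurable_speed :
  bounded_measurable T (fun s => Num.sqrt (w1 s ^+ 2 + w2 s ^+ 2)).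
Proof.
by apply: bounded_measurable_sqrt; apply: (bounded_measurableD
  (bounded_measurableM b1 b1) (bounded_measurableM b2 b2)).
Qed.

Lemma admissible_primitive (f : pt R -> R) : coords f ->
  primitive T (f \o h) (fun s => f (dyn (w1 s) (w2 s) (h s))).
Proof.
have [_ _ _ ch eh] := hadm.
have bh (e : pt R -> R) : coords e -> bounded_measurable T (e \o h).
  by move=> ce; apply: bounded_measurable_within_continuous; exact: ch.
have [bx by_ _ _ _] := coordsP bh.
move=> cf; split; [exact: bh| |by move=> s sT; exact: eh].
have bc x g (bg : bounded_measurable T g) :=
  bounded_measurableM (bounded_measurable_cst T x) bg.
have br := bc 2^-1 _ (bounded_measurableD (bounded_measurableM bx bx)
                                          (bounded_measurableM by_ by_)).
case: cf => [->|[->|[->|[->|->]]]] //.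
- have := bounded_measurableD (bounded_measurableM b1 (bc (- 2^-1) _ by_))
                              (bounded_measurableM b2 (bc (2^-1) _ bx)).
  by congr bounded_measurable; apply/funext => s /=; field.
- have := bounded_measurableM b2 br.
  by congr bounded_measurable; apply/funext => s /=; field.
- have := bounded_measurableM b1 (bc (-1) _ br).
  by congr bounded_measurable; apply/funext => s /=; field.
Qed.

(** Bounded controls give a finite length, so the extended integral is the real number fed to
    [calibration]. *)
Lemma sr_lengthE : sr_length T w1 w2 =
  (Rintegral (mu R) `[0, T] (fun s => Num.sqrt (w1 s ^+ 2 + w2 s ^+ 2)))%:E.
Proof.
rewrite /Rintegral fineK//; apply: integrable_fin_num => //.
exact: (bounded_measurable_integrable (@subset_refl _ _)
          bounded_measurable_speed).
Qed.

Lemma calibration_admissible (a b k m : R) : a ^+ 2 + b ^+ 2 = 1 ->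
  calibration a b k m
    (Rintegral (mu R) `[0, T] (fun s => Num.sqrt (w1 s ^+ 2 + w2 s ^+ 2))) (h T)
  <= calibration a b k m 0 (h 0).
Proof.
move=> ab.
have := @calibration_derivation _ (primitive T) a b k m h w1 w2 _ _ ab
  (@primitive_cst R T) (@primitiveD R T) (@primitiveM R T)
  admissible_primitive (primitive_Rintegral bounded_measurable_speed).
move=> [phi pphi phiE].
(* The length [0] at the initial point is read as the integral of the speed over [[0, 0]]. *)
have L0 := Rintegral_set1 (fun s => Num.sqrt (w1 s ^+ 2 + w2 s ^+ 2)) 0.
rewrite -[X in _ <= calibration a b k m X _]L0 -set_itv1.
apply: (primitive_le T0 pphi) => s _; rewrite phiE.
apply: calibration_rate_le0; first exact: sqrtr_ge0.
rewrite sqr_sqrtr ?addr_ge0 ?sqr_ge0//.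
have b2' : b ^+ 2 = 1 - a ^+ 2 by rewrite -ab; ring.
by ring: b2'.
Qed.

End admissible.

(** * The Euler soliton *)

Definition has_derivative (R : realType) (F f : R -> R) : Prop :=
  forall t : R, is_derive t 1 F (f t).

Section has_derivative.
Context (R : realType).
Implicit Types (F G f g : R -> R).

Lemma has_derivative_cst (x : R) : has_derivative (cst x) (cst 0).
Proof. by move=> t; exact: is_derive_cst. Qed.

Lemma has_derivativeD F G f g : has_derivative F f -> has_derivative G g ->
  has_derivative (F \+ G) (f \+ g).
Proof. by move=> Ff Gg t; exact: is_deriveD. Qed.

Lemma has_derivativeM F G f g : has_derivative F f -> has_derivative G g ->
  has_derivative (F \* G) (f \* G \+ F \* g).
Proof.
move=> Ff Gg t; have FGt := is_deriveM (Ff t) (Gg t).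
by apply: is_derive_eq => /=; rewrite addrC /GRing.scale/= mulrC.
Qed.

Lemma has_derivativeZ F f (x : R) : has_derivative F f ->
  has_derivative (fun t => x * F t) (fun t => x * f t).
Proof.
move=> Ff t; have := has_derivativeM (has_derivative_cst x) Ff t.
by move=> D; apply: is_derive_eq => /=; rewrite mul0r add0r.
Qed.

Lemma has_derivative_comp F G f g : has_derivative F f -> has_derivative G g ->
  has_derivative (F \o G) ((f \o G) \* g).
Proof. by move=> Ff Gg t; apply: is_derive1_comp; [exact: Ff|exact: Gg]. Qed.

Lemma has_derivative_eq F f g : has_derivative F f -> f =1 g ->
  has_derivative F g.
Proof. by move=> Ff fg t; rewrite -fg; exact: Ff. Qed.

Lemma has_derivativeV F f : has_derivative F f -> (forall t, F t != 0) ->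
  has_derivative (fun t => (F t)^-1) (fun t => - (f t / F t ^+ 2)).
Proof.
move=> Ff F0 t; have Ft := Ff t.
have := is_deriveV (F0 t) Ft => D.
by apply: is_derive_eq; rewrite /GRing.scale/= mulNr mulrC.
Qed.

Lemma has_derivative0 F f s t : has_derivative F f -> (forall t, f t = 0) ->
  F s = F t.
Proof.
by move=> Ff f0; apply: is_derive_0_is_cst => x; rewrite -(f0 x); exact: Ff.
Qed.

Lemma has_derivative_ge0 F f s t : has_derivative F f ->
  (forall t, 0 <= f t) -> s <= t -> F s <= F t.
Proof.
move=> Ff f0 st.
have dF x : derivable F x 1 by have [] := Ff x.
apply: (@ger0_derive1_le_cc _ F s t) => //.
- move=> x _; rewrite derive1E.
  by have := Ff x => Fx; rewrite (@derive_val _ _ _ _ _ _ _ Fx).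
- apply: continuous_subspaceT => x.
  by apply: differentiable_continuous; apply/derivable1_diffP.
- by rewrite in_itv/= lexx.
- by rewrite in_itv/= st lexx.
Qed.

End has_derivative.

(* Since |2 c c'| <= (1 + K) c ^+ 2, the function c ^+ 2 * exp ((1 + K) t) is
   nondecreasing. *)
Lemma linear_growth_neq0_ge0 (R : realType) (c d : R -> R) (K t : R) :
  has_derivative c d -> (forall t, d t ^+ 2 <= K * c t ^+ 2) ->
  0 <= t -> c 0 != 0 -> c t != 0.
Proof.
move=> cd dK t0 c0.
have Dlin := has_derivativeZ (1 + K) (@is_derive_id _ R^o ^~ (1 : R)).
have Dexp := has_derivative_comp (@is_derive_expR R) Dlin.
have DF := has_derivativeM (has_derivativeM cd cd) Dexp.
have := has_derivative_ge0 DF _ t0 => /= cE.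
have {}cE : c 0 ^+ 2 <= c t ^+ 2 * expR ((1 + K) * t).
  move: cE; rewrite mulr0 expR0 mulr1 -!expr2 mulr1; apply => s.
  rewrite (_ : _ + _ = expR ((1 + K) * s) *
    ((c s + d s) ^+ 2 + (K * c s ^+ 2 - d s ^+ 2))); last by ring.
  by rewrite mulr_ge0 ?expR_ge0// addr_ge0 ?sqr_ge0// subr_ge0.
apply: contraNneq c0 => ct.
by move: cE; rewrite ct expr0n/= mul0r real_exprn_even_le0// num_real.
Qed.

(** Negative times reduce to positive ones by time reversal, which changes the sign of the
    derivative but not its square. *)
Lemma linear_growth_neq0 (R : realType) (c d : R -> R) (K t : R) :
  has_derivative c d -> (forall t, d t ^+ 2 <= K * c t ^+ 2) ->
  c 0 != 0 -> c t != 0.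
Proof.
move=> cd dK c0; have [t0|t0] := leP 0 t.
  exact: linear_growth_neq0_ge0 cd dK t0 c0.
have Dneg := has_derivativeZ (-1) (@is_derive_id _ R^o ^~ (1 : R)).
have := linear_growth_neq0_ge0 (has_derivative_comp cd Dneg).
move=> /(_ K (- t)); rewrite /= !mulN1r !opprK oppr0; apply => //.
  by move=> s; rewrite mulrN1 sqrrN.
by rewrite oppr_ge0 ltW.
Qed.

(** * Angles whose cosine is [-1] *)

Lemma cosDz2pi (R : realType) (x : R) (k : int) :
  cos (x + k%:~R * (2 * pi)) = cos x.
Proof.
have E (y : R) n : cos (y + n%:R * (2 * pi)) = cos y.
  by rewrite mulr_natl [2 * pi]mulr_natl (periodicn (@cosD2pi R)).
case: k => n; first by rewrite -pmulrn E.
by rewrite NegzE mulrNz mulNr -pmulrn -[LHS](E _ n.+1) subrK.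
Qed.

(** After reduction to [y] in [[0, 2 pi[], the number [|y - pi|] lies in [[0, pi]], where the cosine
    is injective, and its cosine is [- cos y = 1]. *)
Lemma cos_eqN1 (R : realType) (x : R) : cos x = - 1 ->
  exists k : int, x = pi + 2 * k%:~R * pi.
Proof.
move=> cosx; pose k := Num.floor (x / (2 * pi)).
have pi2 : 0 < 2 * pi :> R by rewrite mulr_gt0 ?pi_gt0.
have /andP[kx xk] : k%:~R * (2 * pi) <= x < (k + 1)%:~R * (2 * pi).
  by rewrite -ler_pdivlMr// -ltr_pdivrMr// floor_le floorD1_gt.
pose y := x - k%:~R * (2 * pi).
have cosy : cos y = - 1 by rewrite -(cosDz2pi y k) subrK.
have cos_z : cos `|y - pi| = cos 0.
  by rewrite cos_norm cosB cosy cospi sinpi cos0; ring.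
exists k; move: cos_z => /cos_inj -/(_ _ _)/eqP.
rewrite normr_eq0 subr_eq0 /y => z0.
have /eqP : x - k%:~R * (2 * pi) == pi.
  apply: z0; last by rewrite in_itv/= lexx pi_ge0.
  rewrite in_itv/= normr_ge0 ler_norml.
  by move: kx xk; rewrite intrD mulrDl mul1r; lra.
by lra.
Qed.

(** * First integrals of the soliton and its minimality *)

Section soliton.
Context (R : realType) (th0 c0 alpha beta : R) (th c : R -> R) (g : R -> pt R).
Hypotheses (lambda_C3 : in_C3 th0 c0 alpha beta)
  (gE : is_Exp th0 c0 alpha beta th c g).

Let a := cos beta.
Let b := sin beta.
(** Both constants are fixed at time [0]: [across] is [-k] at the origin, so [c = - alpha across]
    there, and [m] is the value of [-2 sin phi / c]. That [c0] is nonzero follows from [c_neq0]. *)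
Let k := c0 / alpha.
Let m := - 2 * sin (th0 - beta) / c0.
Let phi t := th t - beta.

Let ab : a ^+ 2 + b ^+ 2 = 1. Proof. exact: cos2Dsin2. Qed.

Let alpha_gt0 : 0 < alpha. Proof. by case: lambda_C3. Qed.

Let g0 : g 0 = origin R. Proof. by case: gE. Qed.

Let Dphi : has_derivative phi c.
Proof.
case: gE => _ _ _ gE'.
have Dth : has_derivative th c by move=> t; have [] := gE' t.
apply: (has_derivative_eq (has_derivativeD Dth (has_derivative_cst (- beta)))).
by move=> t /=; rewrite addr0.
Qed.

Let Dc : has_derivative c (fun t => - alpha * sin (phi t)).
Proof. by case: gE => _ _ _ gE' t; have [] := gE' t. Qed.

Let Dg (f : pt R -> R) : coords f ->
  has_derivative (f \o g) (fun t => f (dyn (cos (th t)) (sin (th t)) (g t))).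
Proof. by move=> cf; case: gE => _ _ _ gE' t; have [_ _] := gE' t; apply. Qed.

Let Dsin : has_derivative (sin \o phi) (fun t => cos (phi t) * c t).
Proof. exact: (has_derivative_comp (@is_derive_sin R) Dphi). Qed.

Let Dcos : has_derivative (cos \o phi) (fun t => - sin (phi t) * c t).
Proof. exact: (has_derivative_comp (@is_derive_cos R) Dphi). Qed.

Let cos_phi t : a * cos (th t) + b * sin (th t) = cos (phi t).
Proof. by rewrite cosB mulrC [b * _]mulrC. Qed.

Let sin_phi t : - b * cos (th t) + a * sin (th t) = sin (phi t).
Proof. by rewrite sinB /a /b; ring. Qed.

(** By [sin_phi], [sin phi] is the velocity of [across], so the pendulum equation integrates: the
    curvature of an elastica is affine in position. *)
Let c_across t : c t = - alpha * across a b k (g t).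
Proof.
have [Dx Dy _ _ _] := coordsP Dg.
have D := has_derivativeD Dc (has_derivativeD
  (has_derivativeZ (- alpha * b) Dx) (has_derivativeZ (alpha * a) Dy)).
have := has_derivative0 t 0 D; rewrite /= g0 => cst.
have c00 : c 0 = c0 by case: gE.
move: cst; rewrite c00 /= !mulr0 !addr0 /across /k => cst.
have <- := cst _; first by field; rewrite gt_eqF.
by move=> s; rewrite -sin_phi; ring.
Qed.

(** Conservation of energy, at the critical level [E = alpha]. *)
Let energyE t : c t ^+ 2 = 2 * alpha * (1 + cos (phi t)).
Proof.
have D := has_derivativeD (has_derivativeM Dc Dc)
  (has_derivativeZ (- (2 * alpha)) Dcos).
have [_ E0 _] := lambda_C3; have [th00 c00 _ _] := gE.
have := has_derivative0 t 0 D; rewrite /= /phi th00 c00 => cst.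
move: E0; rewrite /energy => E0.
have : c t * c t + - (2 * alpha) * cos (th t - beta) = 2 * alpha.
  rewrite cst; first by lra.
  by move=> s; ring.
by rewrite /phi expr2; lra.
Qed.

Let sin2E t : sin (phi t) ^+ 2 = (1 - cos (phi t)) * (1 + cos (phi t)).
Proof. by rewrite sin2cos2; ring. Qed.

(** At the critical level [c'^2 = alpha^2 (1 - cos phi) (1 + cos phi) <= alpha c^2], so a zero of
    [c] would force [c 0 = 0]. Then [cos phi = -1] at time [0], the equilibrium excluded from
    [C3]. *)
Let c_neq0 t : c t != 0.
Proof.
apply: (linear_growth_neq0 (K := alpha) t Dc).
  move=> s; rewrite exprMn sqrrN sin2E.
  rewrite [leRHS](_ : _ = alpha ^+ 2 * (2 * (1 + cos (phi s)))); last first.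
    by rewrite energyE; ring.
  have := cos_geN1 (phi s); move=> cN1.
  by rewrite ler_wpM2l ?sqr_ge0// ler_wpM2r//; lra.
apply/eqP => c00; have [th00 _ _ _] := gE.
have /eqP := energyE 0; rewrite c00 expr0n/= eq_sym mulf_eq0 mulf_eq0.
rewrite pnatr_eq0/= gt_eqF//= /phi th00 => /eqP cosN1.
have [_ _] := lambda_C3; apply.
apply: cos_eqN1; lra.
Qed.

(** On the soliton the momentum is [dq/de = Y sin phi / (1 + cos phi) = -2 sin phi / c]. The
    identity holds because [t + X - 2 sin phi / c] is constant. *)
Let momentumE t : momentum a b m t (g t) * c t = - 2 * sin (phi t).
Proof.
have [Dx Dy _ _ _] := coordsP Dg.
have DX := has_derivativeD (has_derivativeZ a Dx) (has_derivativeZ b Dy).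
have Did : has_derivative id (cst (1 : R)).
  by move=> s; exact: is_derive_id.
have D := has_derivativeD (has_derivativeD Did DX)
  (has_derivativeZ (- 2) (has_derivativeM Dsin (has_derivativeV Dc c_neq0))).
have := has_derivative0 t 0 D; rewrite /= g0 => cst.
have [th00 c00 _ _] := gE.
have {}cst : t + (a * px (g t) + b * py (g t)) + - 2 * (sin (phi t) / c t) = m.
  rewrite cst.
    by rewrite /phi th00 c00 /m /=; ring.
  move=> s; rewrite cos_phi.
  have := energyE s; have := sin2E s; have := c_neq0 s.
  move: (c s) (cos _) (sin _) => x y z x0 zE xE.
  have -> : y * x / x = y by rewrite mulfK.
  (* Thus [(sin phi / c)' = cos phi + (1 - cos phi) / 2], and twice this cancels
     [(t + X)' = 1 + cos phi]. *)
  have -> : z * - (- alpha * z / x ^+ 2) = (1 - y) / 2.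
    have y0 : 1 + y != 0.
      by apply: contraNneq x0 => y0; move/eqP: xE; rewrite y0 mulr0 sqrf_eq0.
    rewrite xE (_ : z * _ = alpha * z ^+ 2 / (2 * alpha * (1 + y)));
      last by ring.
    by rewrite zE; field; rewrite y0 gt_eqF.
  by field.
by rewrite /momentum /along -cst; field; rewrite c_neq0.
Qed.

(** This is the equality case of [calibration_rate_le0] at unit speed: [p (1 + cos phi) = q sin phi]
    and [q (1 - cos phi) = p sin phi]. *)
Let calibrationE t : calibration a b k m t (g t) = calibration a b k m 0 (g 0).
Proof.
have Did : has_derivative id (cst (1 : R)).
  by move=> s; exact: is_derive_id.
have [f Df fE] := @calibration_derivation _ (@has_derivative R) a b k m g
  (fun t => cos (th t)) (fun t => sin (th t)) _ _ ab
  (@has_derivative_cst R) (@has_derivativeD R) (@has_derivativeM R) Dg Did.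
apply: (has_derivative0 t 0 Df) => s; rewrite fE /= cos_phi sin_phi.
have := momentumE s; have := energyE s; have := sin2E s.
have := c_across s; have := c_neq0 s.
move: (across _ _ _ _) (momentum _ _ _ _ _) (c s) (cos _) (sin _).
move=> q p x y z x0 xq zE xE pE.
(* The rate involves [p] and [q] only through [p q], [q^2] and [p^2 (1 + cos phi)], each a function
   of [phi] over [alpha]. *)
have pq : p * q = 2 * z / alpha.
  apply/eqP; rewrite eq_sym -(inj_eq (mulfI (lt0r_neq0 alpha_gt0))).
  apply/eqP; rewrite mulrC divfK ?gt_eqF//.
  by rewrite -[LHS]opprK -mulNr -pE xq; ring.
have q2 : q ^+ 2 = 2 * (1 + y) / alpha.
  have : alpha ^+ 2 * q ^+ 2 = alpha ^+ 2 * (2 * (1 + y) / alpha).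
    rewrite -exprMn -sqrrN -mulNr -xq xE; field; exact: lt0r_neq0.
  by apply: mulfI; rewrite expf_neq0// gt_eqF.
have p2 : p ^+ 2 * (1 + y) = 2 * z ^+ 2 / alpha.
  have : (2 * alpha) * (p ^+ 2 * (1 + y)) = 2 * alpha * (2 * z ^+ 2 / alpha).
    rewrite (_ : _ * _ = (p * x) ^+ 2); last by rewrite exprMn xE; ring.
    by rewrite pE; field; exact: lt0r_neq0.
  by apply: mulfI; rewrite mulf_neq0 ?pnatr_eq0// gt_eqF.
rewrite p2 pq q2; field: zE; exact: lt0r_neq0.
Qed.

Lemma soliton_minimizing t : 0 <= t -> minimizing_on t th g.
Proof.
move=> t0 w1 w2 h hadm h0 ht.
have := calibration_admissible t0 hadm k m ab.
rewrite (sr_lengthE hadm) h0 ht -(calibrationE t).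
set L := Rintegral _ _ _ => Lt.
rewrite /sr_length (eq_integral (fun=> 1%:E)%E); last first.
  by move=> s _; rewrite cos2Dsin2 sqrtr1.
rewrite integral_cst// mul1e /mu.
have := lebesgue_measure_itv `[0, t]; rewrite /= => ->.
rewrite lte_fin; case: ifPn => [t0'|]; last first.
  by rewrite lee_fin Rintegral_ge0// => s _; exact: sqrtr_ge0.
rewrite sube0 lee_fin leNgt; apply/negP => Lt'.
move: Lt; rewrite /calibration leNgt => /negP; apply.
(* The endpoint is common, so [second_moment] cancels and [across] agrees; only the momenta differ,
   and a shorter competitor has the larger one. *)
move: (second_moment _ _ _ _) => S; rewrite -!addrA ltrD2l.
have pp : momentum a b m t (g t) < momentum a b m L (g t).
  by rewrite /momentum ltrD2r ltrD2l ltrN2.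
move: (momentum a b m t _) (momentum a b m L _) pp => p p' pp.
have q0 : 0 <= across a b k (g t) ^+ 2 / 2 by rewrite divr_ge0 ?sqr_ge0.
rewrite ler_ltD ?ler_wpM2r ?(ltW pp)//.
rewrite ltr_pM2r ?invr_gt0// -subr_gt0.
(* The second factor is [p'^2 + p' p + p^2] with the square completed; it vanishes only for
   [p = p' = 0], contrary to [p < p']. *)
rewrite (_ : _ - _ = (p' - p) * ((p' + p / 2) ^+ 2 + 3 / 4 * p ^+ 2));
  last by field.
have p2 : 0 <= 3 / 4 * p ^+ 2 by rewrite mulr_ge0 ?sqr_ge0// divr_ge0.
rewrite mulr_gt0 ?subr_gt0// lt0r addr_ge0 ?sqr_ge0// andbT.
apply: contraTneq pp => /eqP; rewrite paddr_eq0 ?sqr_ge0// sqrf_eq0.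
move=> /andP[/eqP pp]; rewrite mulf_eq0 sqrf_eq0 => /orP[/eqP|/eqP p0]; lra.
Qed.

End soliton.

Theorem theorem6p2 (R : realType) (th0 c0 alpha beta : R)
  (th c : R -> R) (g : R -> pt R) :
  in_C3 th0 c0 alpha beta ->
  is_Exp th0 c0 alpha beta th c g ->
  t_cut th g = +oo%E /\ t_conj1 th g = +oo%E /\ t_MAX1_C3 R = +oo%E.
Proof.
move=> C3 gE.
have sup_pos (P : R -> Prop) : (forall t, 0 < t -> P t) ->
    ereal_sup [set t%:E | t in [set t : R | 0 < t /\ P t]] = +oo%E.
  (* Each positive real belongs to the set, so the supremum exceeds every bound. *)
  move=> Pt; apply/eqyP => A A0.
  by apply: ereal_sup_ubound; exists A => //; split; last exact: Pt.
have min t : 0 < t -> minimizing_on t th g.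
  by move=> /ltW; exact: (soliton_minimizing C3 gE).
split; first exact: sup_pos.
(* Global minimality gives local optimality in a neighbourhood of any size; [1] is an arbitrary
   choice. *)
split=> //; apply: sup_pos => t t0; exists 1 => // w1 w2 h hadm _.
exact: min.
Qed.
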